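(* Let $x\in\mathbb{Z}^2$ and let $(S_n^{(1)})_{n\in\mathbb{N}}$ and $(S_n^{(2)})_{n\in\mathbb{N}}$ be two independent random walks in $\mathbb{Z}^2$ with the same law, each starting at $x$. That is, $S_0^{(i)}=x$ and $S_n^{(i)}=x+X_1^{(i)}+\cdots+X_n^{(i)}$ for $n\ge 1$ and $i=1,2$, where the sequences $(X_k^{(1)})_{k\ge1}$ and $(X_k^{(2)})_{k\ge1}$ are independent of each other, and each consists of i.i.d. $\mathbb{Z}^2$-valued random variables with one and the same common law $\mu$. Assume the walks are square integrable, i.e. $\mathbb{E}\big(\|X_1^{(1)}\|_2^2\big)<\infty$, where $\|\cdot\|_2$ is the Euclidean norm. Then, with probability one, $S_n^{(1)}=S_n^{(2)}$ for infinitely many $n\in\mathbb{N}$.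
   Context: A random walk in $\mathbb{Z}^2$ starting at $x\in\mathbb{Z}^2$ is a sequence $S_0=x$, $S_n=x+X_1+\cdots+X_n$, where $(X_n)_{n\ge1}$ are i.i.d. $\mathbb{Z}^2$-valued random variables. It is called square integrable if $\mathbb{E}(\|X_1\|_2^2)<\infty$. Two walks are identically distributed when they have the same starting point and the same step law. *)

(* Defs.v *)
From HB Require Import structures.
From mathcomp Require Import all_boot all_order all_algebra.
From mathcomp Require Import all_classical all_reals all_analysis.
Set Implicit Arguments. Unset Strict Implicit. Unset Printing Implicit Defensive.
Import Order.TTheory GRing.Theory Num.Theory.
Local Open Scope classical_set_scope.
Local Open Scope ring_scope.

Definition Z2 := (int * int)%type.

Definition sqnorm2 (R : realType) (z : Z2) : R :=
  (z.1)%:~R ^+ 2 + (z.2)%:~R ^+ 2.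

Section Defs.
Context {d : measure_display} {T : measurableType d} {R : realType}.
Variable (P : probability T R).

(* A Z^2-valued random variable (Z^2 carries the discrete sigma-algebra). *)
Definition Z2_rv (Y : T -> Z2) : Prop :=
  forall z : Z2, measurable [set w | Y w = z].

Definition mutually_independent {I : eqType} (Y : I -> T -> Z2) : Prop :=
  forall (J : seq I) (B : I -> set Z2), uniq J ->
    P [set w | forall j, j \in J -> B j (Y j w)]
    = (\prod_(j <- J) P (Y j @^-1` B j))%E.

Definition same_law (Y1 Y2 : T -> Z2) : Prop :=
  forall B : set Z2, P (Y1 @^-1` B) = P (Y2 @^-1` B).
End Defs.

Definition walk {T : Type} (x : Z2) (Y : nat -> T -> Z2) (n : nat) (w : T) : Z2 :=
  x + \sum_(1 <= k < n.+1) Y k w.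

(* Main.v *)
(** The difference D_n = S_n^(1) - S_n^(2) is a symmetric walk, which makes
    centering unnecessary: by the parallelogram law E|D_n|^2 = n E|D_1|^2 = n s.
    By Chebyshev's inequality D_n lies with probability at least 1/2 in a box
    of O(n) points. As D_2n vanishes when D_n equals an independent copy of
    itself, Cauchy-Schwarz gives P(D_2n = 0) >= c / n, so the return
    probabilities have a divergent sum. Let q_N be the probability of no
    return up to time N. Decomposing along the last return before N yields
    q_N * sum_(n <= N) P(D_n = 0) <= 1, hence q_N tends to 0, and each event
    "n is the last return time" has probability at most q_N for all N.
    Only laws of finite samples occur; they take countably many values. *)
Require Import Defs.
From HB Require Import structures.
From mathcomp Require Import all_boot all_order all_algebra.
From mathcomp Require Import all_classical all_reals all_analysis.
From mathcomp Require Import measurable_realfun.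
From mathcomp Require Import zify ring lra.
Import Order.TTheory GRing.Theory Num.Theory.
Local Open Scope classical_set_scope.
Local Open Scope ring_scope.

(** * Random variables with countably many values *)

Section DiscreteRandomVariables.
Context {d : measure_display} {T : measurableType d} {R : realType}.
Variable P : probability T R.
Implicit Types C : countType.

(** [C] carries no sigma-algebra here; asking for all preimages amounts to the discrete one, so
    every function of [V] is measurable. *)
Definition discrete_rv {C} (V : T -> C) :=
  forall A : set C, measurable (V @^-1` A).

Lemma discrete_rvP {C} {V : T -> C} :
  (forall c, measurable [set w | V w = c]) -> discrete_rv V.
Proof.
move=> mV A.
rewrite (_ : V @^-1` A = \bigcup_(n in [set: nat])
   (if unpickle n is Some c then [set w | V w = c /\ A c] else set0)); last first.
  apply/seteqP; split=> [w Aw|w [n _]] /=.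
    by exists (pickle (V w)) => //; rewrite pickleK.
  by case: unpickle => // c [-> ].
apply: bigcup_measurable => n _.
case: unpickle => [c|]; last exact: measurable0.
case: (pselect (A c)) => Ac.
  rewrite (_ : [set w | _] = [set w | V w = c]) //.
  by apply/seteqP; split=> w //= [].
rewrite (_ : [set w | _] = set0) //.
by apply/seteqP; split=> w //= [].
Qed.

Lemma discrete_rv_comp {C C'} (f : C -> C') {V : T -> C} :
  discrete_rv V -> discrete_rv (f \o V).
Proof. by move=> mV A; exact: (mV (f @^-1` A)). Qed.

(** Slicing by [pickle] code rather than by value gives a series over the naturals; codes outside
    the range of [V] contribute the empty set. *)
Lemma total_probability {C} {V : T -> C} {E : set T} :
  discrete_rv V -> measurable E ->
  P E = (\sum_(n <oo) P (E `&` [set w | pickle (V w) = n]))%E.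
Proof.
move=> mV mE; rewrite -measure_semi_bigcup.
- congr (P _); apply/seteqP; split=> [w Ew|w [n _ []]//].
  by exists (pickle (V w)).
- by move=> n; apply: measurableI => //; exact: (mV (pickle @^-1` [set n])).
- by move=> i j _ _ [w [[_ /= <-] [_ /= <-]]].
- apply: bigcup_measurable => n _; apply: measurableI => //.
  exact: (mV (pickle @^-1` [set n])).
Qed.

Lemma same_pmf_law {C} {V W : T -> C} : discrete_rv V -> discrete_rv W ->
  (forall c, P [set w | V w = c] = P [set w | W w = c]) ->
  forall A, P (V @^-1` A) = P (W @^-1` A).
Proof.
move=> mV mW VW A.
rewrite (total_probability mV (mV A)) (total_probability mW (mW A)).
apply: eq_eseriesr => n _.
case: (pselect (exists2 c, A c & pickle c = n)) => [[c Ac <-]|nA].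
  rewrite (_ : _ `&` _ = [set w | V w = c]); last first.
    apply/seteqP; split=> w /=.
      by move=> [_ /(pcan_inj pickleK)].
    by move=> ->.
  rewrite VW; congr (P _); apply/seteqP; split=> w /=.
    by move=> ->.
  by move=> [_ /(pcan_inj pickleK)].
rewrite (_ : _ `&` _ = set0); last first.
  by apply/seteqP; split=> w //= [Aw e]; apply: nA; exists (V w).
congr (P _).
by apply/seteqP; split=> w //= [Aw e]; apply: nA; exists (W w).
Qed.

Lemma discrete_independence {C C'} {V : T -> C} {W : T -> C'} :
  discrete_rv V -> discrete_rv W ->
  (forall c c', P [set w | V w = c /\ W w = c'] =
     (P [set w | V w = c] * P [set w | W w = c'])%E) ->
  forall A B, P (V @^-1` A `&` W @^-1` B) = (P (V @^-1` A) * P (W @^-1` B))%E.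
Proof.
move=> mV mW VW.
(* The factorization is extended one coordinate at a time: [B] first, with [c] fixed, then [A]. *)
have H1 c B : P ([set w | V w = c] `&` W @^-1` B) =
    (P [set w | V w = c] * P (W @^-1` B))%E.
  have mc : measurable [set w | V w = c] by exact: (mV [set c]).
  have finc := fin_num_measure P _ mc.
  rewrite (total_probability mW (measurableI _ _ mc (mW B))).
  rewrite (total_probability mW (mW B)) -(fineK finc) -nneseriesZl; last first.
    by move=> n _; exact: measure_ge0.
  rewrite fineK //; apply: eq_eseriesr => n _.
  case: (pselect (exists2 c', B c' & pickle c' = n)) => [[c' Bc' <-]|nB].
    rewrite (_ : _ `&` _ `&` _ = [set w | V w = c /\ W w = c']); last first.
      apply/seteqP; split=> w /=.
        by move=> [[-> _] /(pcan_inj pickleK)].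
      by move=> [-> ->].
    rewrite VW; congr (_ * P _)%E; apply/seteqP; split=> w /=.
      by move=> ->.
    by move=> [_ /(pcan_inj pickleK)].
  rewrite (_ : _ `&` _ `&` _ = set0); last first.
    by apply/seteqP; split=> w //= [[_ Bw] e]; apply: nB; exists (W w).
  rewrite (_ : W @^-1` _ `&` _ = set0); last first.
    by apply/seteqP; split=> w //= [Bw e]; apply: nB; exists (W w).
  by rewrite measure0 mule0.
move=> A B.
have finB := fin_num_measure P _ (mW B).
rewrite (total_probability mV (measurableI _ _ (mV A) (mW B))).
rewrite (total_probability mV (mV A)) muleC -(fineK finB) -nneseriesZl; last first.
  by move=> n _; exact: measure_ge0.
rewrite fineK //; apply: eq_eseriesr => n _.
case: (pselect (exists2 c, A c & pickle c = n)) => [[c Ac <-]|nA].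
  rewrite (_ : _ `&` _ `&` _ = [set w | V w = c] `&` W @^-1` B); last first.
    apply/seteqP; split=> w /=.
      by move=> [[_ Bw] /(pcan_inj pickleK)].
    by move=> [-> ?].
  rewrite H1 muleC; congr (_ * P _)%E; apply/seteqP; split=> w /=.
    by move=> ->.
  by move=> [_ /(pcan_inj pickleK)].
rewrite (_ : _ `&` _ `&` _ = set0); last first.
  by apply/seteqP; split=> w //= [[Aw _] e]; apply: nA; exists (V w).
rewrite (_ : V @^-1` _ `&` _ = set0); last first.
  by apply/seteqP; split=> w //= [Aw e]; apply: nA; exists (V w).
by rewrite measure0 mule0.
Qed.

Lemma measurable_fun_discrete {C} {V : T -> C} (f : C -> \bar R) :
  discrete_rv V -> measurable_fun setT (f \o V).
Proof. by move=> mV _ B _; rewrite setTI; exact: (mV (f @^-1` B)). Qed.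

Lemma same_law_integral {C} {V W : T -> C} (f : C -> \bar R) :
  discrete_rv V -> discrete_rv W -> (forall c, (0 <= f c)%E) ->
  (forall A, P (V @^-1` A) = P (W @^-1` A)) ->
  (\int[P]_w f (V w) = \int[P]_w f (W w))%E.
Proof.
move=> mV mW f0 VW.
(* The integrals are transported along [pickle] to the naturals. The default 0 is harmless, since
   [pickle (V w)] always decodes. *)
pose g n : \bar R := if @unpickle C n is Some c then f c else 0%E.
have g0 n : (0 <= g n)%E by rewrite /g; case: unpickle.
have mp (V' : T -> C) : discrete_rv V' -> measurable_fun setT (pickle \o V').
  by move=> mV' _ B _; rewrite setTI; exact: (mV' (pickle @^-1` B)).
have E (V' : T -> C) (mV' : discrete_rv V') : (\int[P]_w f (V' w) =
    \int[pushforward P (pickle \o V')]_n g n)%E.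
  rewrite ge0_integral_pushforward//; last exact: mp.
  by apply: eq_integral => w _; rewrite /g /= pickleK.
rewrite (E _ mV) (E _ mW).
have -> // : pushforward P (pickle \o V) = pushforward P (pickle \o W).
by apply/funext => A; exact: (VW (pickle @^-1` A)).
Qed.

End DiscreteRandomVariables.

(** * Collision probability and Chebyshev's inequality *)

Section CollisionAndChebyshev.
Context {d : measure_display} {T : measurableType d} {R : realType}.
Variable P : probability T R.

Definition pr (E : set T) : R := fine (P E).

Lemma prE {E} : measurable E -> P E = (pr E)%:E.
Proof. by move=> mE; rewrite /pr fineK // fin_num_measure. Qed.

Lemma pr_ge0 E : 0 <= pr E.
Proof. exact/fine_ge0/measure_ge0. Qed.

Lemma pr_setT : pr setT = 1.
Proof. by rewrite /pr probability_setT. Qed.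

Lemma pr_le {A B} : measurable A -> measurable B -> A `<=` B -> pr A <= pr B.
Proof.
by move=> mA mB AB; rewrite -lee_fin -!prE //; apply: le_measure => //; rewrite inE.
Qed.

Lemma pr_setC {A} : measurable A -> pr (~` A) = 1 - pr A.
Proof.
move=> mA; apply: EFin_inj; rewrite -prE; last exact: measurableC.
by rewrite probability_setC // (prE mA).
Qed.

Lemma pr_mem_seq {C : countType} {V : T -> C} {E : set T} {F : seq C} :
  discrete_rv V -> measurable E -> uniq F ->
  pr (E `&` [set w | V w \in F]) = \sum_(c <- F) pr (E `&` [set w | V w = c]).
Proof.
move=> mV mE; elim: F => [_|c F IH /= /andP[cF uF]].
  rewrite big_nil (_ : _ `&` _ = set0) /pr ?measure0 //.
  by apply/seteqP; split=> w //= [].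
rewrite big_cons -IH //.
rewrite (_ : E `&` [set w | V w \in c :: F] =
   (E `&` [set w | V w = c]) `|` (E `&` [set w | V w \in F])); last first.
  apply/seteqP; split=> w /=.
    by rewrite inE => -[Ew /orP[/eqP|]]; [left|right].
  by move=> [[Ew ->]|[Ew wF]]; rewrite inE ?eqxx // wF orbT.
have m1 : measurable (E `&` [set w | V w = c]).
  by apply: measurableI => //; exact: (mV [set c]).
have m2 : measurable (E `&` [set w | V w \in F]).
  by apply: measurableI => //; exact: (mV [set c | c \in F]).
apply: EFin_inj; rewrite EFinD -!prE //; last exact: measurableU.
rewrite measureU //.
apply/seteqP; split=> w //= [[_ Vc] [_]].
by rewrite Vc (negbTE cF).
Qed.

(** Expand the sum of [(a i - t) ^+ 2 >= 0]. A free [t] passes through the induction; taking [t] to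
    be the mean recovers Cauchy-Schwarz. *)
Lemma sum_sqr_ge (I : Type) (F : seq I) (a : I -> R) (t : R) :
  2 * t * (\sum_(i <- F) a i) - t ^+ 2 * (size F)%:R <= \sum_(i <- F) a i ^+ 2.
Proof.
elim: F => [|i F IH]; first by rewrite !big_nil mulr0 mulr0 subr0.
rewrite !big_cons /= -natr1.
have := sqr_ge0 (a i - t); move: IH; set S1 := \sum_(_ <- _) _.
set S2 := \sum_(_ <- _) _; nra.
Qed.

(* For independent V, W with the same law, P(V = W) is the sum of the squares
   of the point masses; Cauchy-Schwarz bounds it from below over F. *)
Lemma collision_ge {C : countType} {V W : T -> C} {F : seq C} :
  discrete_rv V -> discrete_rv W -> measurable [set w | V w = W w] ->
  (forall c c', P [set w | V w = c /\ W w = c'] =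
     (P [set w | V w = c] * P [set w | W w = c'])%E) ->
  (forall c, P [set w | V w = c] = P [set w | W w = c]) ->
  uniq F -> (0 < size F)%N ->
  pr [set w | V w \in F] ^+ 2 / (size F)%:R <= pr [set w | V w = W w].
Proof.
move=> mV mW mE iVW eVW uF F0.
have F0' : 0 < (size F)%:R :> R by rewrite ltr0n.
apply: (@le_trans _ _ (pr ([set w | V w = W w] `&` [set w | V w \in F]))); last first.
  apply: pr_le => //; first by apply: measurableI => //; exact: (mV [set c | c \in F]).
rewrite (pr_mem_seq mV mE uF).
rewrite -[X in pr X]setTI (pr_mem_seq mV measurableT uF).
rewrite [leRHS](_ : _ = \sum_(c <- F) pr (setT `&` [set w | V w = c]) ^+ 2); last first.
  apply: eq_bigr => c _; rewrite setTI.
  rewrite (_ : _ `&` _ = [set w | V w = c /\ W w = c]); last first.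
    apply/seteqP; split=> w /=; first by move=> [<- ->].
    by move=> [-> ->].
  by rewrite /pr iVW -eVW fineM ?fin_num_measure//; exact: (mV [set c]).
set S := \sum_(c <- F) _.
have := sum_sqr_ge _ F (fun c => pr (setT `&` [set w | V w = c])) (S / (size F)%:R).
rewrite -/S; set Q := \sum_(c <- F) _; apply: le_trans.
rewrite le_eqVlt; apply/orP; left; apply/eqP.
field. by rewrite gt_eqF.
Qed.

(** Markov's inequality at level [r], with mean at most [r / 2], bounds the complement by 1/2. *)
Lemma chebyshev_half {C : countType} {V : T -> C} (f : C -> R) (r : R) :
  discrete_rv V -> (forall c, 0 <= f c) -> 0 < r ->
  (\int[P]_w (f (V w))%:E <= (r / 2)%:E)%E ->
  2^-1 <= pr [set w | f (V w) < r].
Proof.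
move=> mV f0 r0 le.
have mf := measurable_fun_discrete (fun c => (f c)%:E) mV.
have mA : measurable [set w | r <= f (V w)] by exact: (mV [set c | r <= f c]).
have := @le_integral_abse _ _ _ P _ measurableT _ r mf r0.
rewrite setTI (_ : [set x | _] = [set w | r <= f (V w)]); last first.
  apply/seteqP; split=> w /=; rewrite lee_fin ger0_norm //.
rewrite [X in (_ <= X)%E](_ : _ = \int[P]_w (f (V w))%:E)%E; last first.
  by apply: eq_integral => w _ /=; rewrite ger0_norm.
move=> /le_trans/(_ le) H.
have {}H : r * pr [set w | r <= f (V w)] <= r / 2.
  by rewrite -lee_fin EFinM -(prE mA).
have -> : [set w | f (V w) < r] = ~` [set w | r <= f (V w)].
  by apply/seteqP; split=> w /=; rewrite ltNge => /negP.
rewrite (pr_setC mA).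
have : pr [set w | r <= f (V w)] <= 2^-1; last by lra.
by rewrite -(ler_pM2l r0).
Qed.

End CollisionAndChebyshev.

(** * Laws and independence of finite samples *)

Section IndependentIdenticallyDistributed.
Context {d : measure_display} {T : measurableType d} {R : realType}.
Context {P : probability T R} {I : eqType} {Y : I -> T -> Z2}.
Hypothesis mY : forall i, Z2_rv (Y i).
Hypothesis iY : mutually_independent P Y.
Hypothesis lY : forall i j, same_law P (Y i) (Y j).

Definition sample (Y : I -> T -> Z2) (J : seq I) (w : T) : seq Z2 :=
  [seq Y j w | j <- J].

Lemma sample_rv J : discrete_rv (sample Y J).
Proof.
apply: discrete_rvP; elim: J => [|j J IH] [|z s].
- by rewrite (_ : [set w | _] = setT)//; apply/seteqP; split.
- by rewrite (_ : [set w | _] = set0)//; apply/seteqP; split.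
- by rewrite (_ : [set w | _] = set0)//; apply/seteqP; split.
rewrite (_ : [set w | _] = [set w | Y j w = z] `&` [set w | sample Y J w = s]).
  by apply: measurableI => //; exact: mY.
by apply/seteqP; split=> w /= [-> ->].
Qed.

(** Independence is applied to singletons; equality of laws then replaces every index by the
    reference [i0], so that only the length of [J] matters. *)
Lemma sample_pmf i0 J s : uniq J ->
  P [set w | sample Y J w = s] =
  if size s == size J then (\prod_(z <- s) P [set w | Y i0 w = z])%E else 0%E.
Proof.
move=> uJ; case: eqP => [sz|sz]; last first.
  rewrite (_ : [set w | _] = set0) ?measure0 //.
  by apply/seteqP; split=> w //= e; apply: sz; rewrite -e size_map.
rewrite (_ : [set w | _] =
    [set w | forall j, j \in J -> [set nth 0 s (index j J)] (Y j w)]); last first.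
  apply/seteqP; split=> w /=.
    move=> <- j jJ; rewrite (nth_map j) ?index_mem//.
    by rewrite nth_index.
  move=> H; apply: (@eq_from_nth _ 0); rewrite size_map // => i iJ.
  by rewrite (nth_map i0) // H ?mem_nth // index_uniq.
rewrite (iY J (fun j => [set nth 0 s (index j J)])) //.
rewrite (big_nth i0) [RHS](big_nth 0) sz.
rewrite big_seq_cond [RHS]big_seq_cond; apply: eq_bigr => i.
rewrite andbT mem_index_iota => /= iJ.
rewrite index_uniq // -[LHS]/(P (Y _ @^-1` [set nth 0 s i])).
exact: lY.
Qed.

Lemma sample_law {J K} : uniq J -> uniq K -> size J = size K ->
  forall A, P (sample Y J @^-1` A) = P (sample Y K @^-1` A).
Proof.
(* An empty list supplies no reference index for [sample_pmf]. *)
case: J => [|i0 J] uJ uK sz A.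
  by case: K sz uK.
apply: same_pmf_law; [exact: sample_rv|exact: sample_rv|] => s.
by rewrite !(sample_pmf i0) // sz.
Qed.

Lemma sample_independent_pmf {J K} s t : uniq (J ++ K) ->
  P [set w | sample Y J w = s /\ sample Y K w = t] =
  (P [set w | sample Y J w = s] * P [set w | sample Y K w = t])%E.
Proof.
case: J => [|i0 J] u.
  rewrite [X in (P X * _)%E](_ : _ = [set w | [::] = s]) //.
  case: s => [|z s].
    rewrite [X in (P X * _)%E](_ : _ = setT); last by apply/seteqP; split.
    rewrite probability_setT mul1e; congr (P _).
    by apply/seteqP; split=> w //= [].
  rewrite [X in (P X * _)%E](_ : _ = set0); last by apply/seteqP; split.
  by rewrite (_ : [set w | _] = set0) ?measure0 ?mul0e//; apply/seteqP; split=> w //= [].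
have := u; rewrite cat_uniq => /and3P[uJ _ uK].
have [sz|sz] := eqVneq (size s) (size (i0 :: J)); last first.
  rewrite (sample_pmf i0 _ s) // (negbTE sz) mul0e.
  rewrite (_ : [set w | _] = set0) ?measure0 //.
  apply/seteqP; split=> w //= -[e _].
  by move: sz; rewrite -e /= size_map eqxx.
(* The pair of samples is the sample over the concatenated indices; the known size of [s] tells
   where to cut [s ++ t]. *)
rewrite (_ : [set w | _] = [set w | sample Y ((i0 :: J) ++ K) w = s ++ t]); last first.
  apply/seteqP; split=> w; rewrite /mkset /sample map_cat.
    by move=> [-> ->].
  move=> /eqP; rewrite eqseq_cat; last by rewrite sz /= size_map.
  by move=> /andP[/eqP ? /eqP ?].
rewrite !(sample_pmf i0) // sz eqxx !size_cat sz eqn_add2l.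
by case: eqP => _; rewrite ?mule0 // big_cat.
Qed.

Lemma sample_independent {J K} : uniq (J ++ K) -> forall A B,
  P (sample Y J @^-1` A `&` sample Y K @^-1` B) =
  (P (sample Y J @^-1` A) * P (sample Y K @^-1` B))%E.
Proof.
move=> u; apply: discrete_independence; [exact: sample_rv|exact: sample_rv|].
by move=> s t; exact: sample_independent_pmf.
Qed.

End IndependentIdenticallyDistributed.

(** * Paired differences, index blocks and lattice boxes *)

Fixpoint altsum (s : seq Z2) : Z2 :=
  if s is a :: b :: s' then a - b + altsum s' else 0.

(** An even length keeps the pairs from straddling the junction. *)
Lemma altsum_cat n s t : size s = n.*2 -> altsum (s ++ t) = altsum s + altsum t.
Proof.
elim: n s => [|n IH] [|a [|b s]] //= => [_|[sz]]; first by rewrite add0r.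
by rewrite IH // addrA.
Qed.

Definition block (b : bool) (a n : nat) : seq (bool * nat) :=
  flatten [seq [:: (b, k); (~~ b, k)] | k <- iota a n].

Lemma size_block b a n : size (block b a n) = n.*2.
Proof. by elim: n a => //= n IH a; rewrite -/(block _ _ _) IH. Qed.

Lemma mem_block b a n j : (j \in block b a n) = (a <= j.2 < a + n)%N.
Proof.
elim: n a => [|n IH] a /=; first by rewrite in_nil; lia.
rewrite -/(block _ _ _) !inE {}IH; case: j => i k /=.
have [->|ne] := eqVneq k a; first by case: i; case: b; rewrite ?eqxx //= ; lia.
by rewrite !xpair_eqE (negbTE ne) !andbF /=; lia.
Qed.

Lemma uniq_block b a n : uniq (block b a n).
Proof.
elim: n a => [//|n IH] a /=; rewrite -/(block _ _ _) IH !inE !mem_block /= !ltnn /=.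
by rewrite xpair_eqE; case: (b).
Qed.

Lemma uniq_block_cat b b' a n m : uniq (block b a n ++ block b' (a + n) m).
Proof.
rewrite cat_uniq !uniq_block andbT /=; apply/hasPn => j.
by rewrite !mem_block; lia.
Qed.

Lemma block_cat b a n m : block b a (n + m) = block b a n ++ block b (a + n) m.
Proof. by rewrite /block iotaD map_cat flatten_cat. Qed.

Definition box (M : nat) : seq Z2 :=
  let L := [seq k%:Z - M%:Z | k <- iota 0 M.*2.+1] in [seq (i, j) | i <- L, j <- L].

Lemma size_box M : size (box M) = (M.*2.+1 ^ 2)%N.
Proof. by rewrite size_allpairs !size_map size_iota. Qed.

Lemma uniq_box M : uniq (box M).
Proof.
have uL : uniq [seq k%:Z - M%:Z | k <- iota 0 M.*2.+1].
  by rewrite map_inj_uniq ?iota_uniq // => i j /= /addIr [].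
by apply: allpairs_uniq => // -[? ?] [? ?].
Qed.

Lemma mem_box (R : realType) M z : sqnorm2 R z < M%:R ^+ 2 -> z \in box M.
Proof.
have memL (c : int) : (c%:~R : R) ^+ 2 < M%:R ^+ 2 ->
    c \in [seq k%:Z - M%:Z | k <- iota 0 M.*2.+1].
  (* Casting [M] through the integers moves the comparison there, where it forces [|c| < M]; hence
     [c + M] is a natural number below [2M]. *)
  rewrite -[M%:R]/(M%:Z%:~R) !expr2 -!intrM ltr_int => h.
  apply/seq.mapP; exists (absz (c + M%:Z)); last by nia.
  by rewrite mem_iota; nia.
rewrite /sqnorm2; case: z => i j /= h.
have := sqr_ge0 (i%:~R : R); have := sqr_ge0 (j%:~R : R) => hj hi.
by apply/allpairsP; exists (i, j); split=> //=; apply: memL; lra.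
Qed.

(** * The difference walk and its second moment *)

Section DifferenceWalk.
Context {d : measure_display} {T : measurableType d} {R : realType}.
Context {P : probability T R} {Y : bool * nat -> T -> Z2}.
Hypothesis mY : forall i, Z2_rv (Y i).
Hypothesis iY : mutually_independent P Y.
Hypothesis lY : forall i j, same_law P (Y i) (Y j).

(* Y (i, k) is the (k+1)-th step of walk i. The increment of walk b minus walk
   ~~ b over n steps is read off a finite sample, whose law depends only on the
   size of the index list: b = true gives the opposite walk with the same law. *)
Definition diffw (Y : bool * nat -> T -> Z2) (b : bool) (a n : nat) (w : T) : Z2 :=
  altsum (sample Y (block b a n) w).

Lemma diffw0 b a w : diffw Y b a 0 w = 0.
Proof. by []. Qed.

Lemma diffwS b a n w :
  diffw Y b a n.+1 w = Y (b, a) w - Y (~~ b, a) w + diffw Y b a.+1 n w.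
Proof. by []. Qed.

Lemma diffwD b a n m w :
  diffw Y b a (n + m) w = diffw Y b a n w + diffw Y b (a + n) m w.
Proof.
rewrite /diffw block_cat /sample map_cat (altsum_cat n) //.
by rewrite size_map size_block.
Qed.

Lemma diffwN b a n w : diffw Y (~~ b) a n w = - diffw Y b a n w.
Proof.
elim: n a => [|n IH] a; first by rewrite !diffw0 oppr0.
by rewrite !diffwS IH negbK opprD opprB.
Qed.

Lemma diffw_rv b a n : discrete_rv (diffw Y b a n).
Proof. exact: (discrete_rv_comp altsum (sample_rv mY (block b a n))). Qed.

Lemma diffw_law b b' a a' n A :
  P (diffw Y b a n @^-1` A) = P (diffw Y b' a' n @^-1` A).
Proof.
apply: (sample_law mY iY lY (uniq_block b a n) (uniq_block b' a' n) _ (altsum @^-1` A)).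
by rewrite !size_block.
Qed.

Lemma sqnorm2_ge0 z : 0 <= sqnorm2 R z.
Proof. by rewrite addr_ge0 // sqr_ge0. Qed.

Lemma sqnorm2_parallelogram z1 z2 :
  sqnorm2 R (z1 + z2) + sqnorm2 R (- z1 + z2) = 2 * sqnorm2 R z1 + 2 * sqnorm2 R z2.
Proof. by rewrite /sqnorm2 /= !rmorphD !rmorphN /=; ring. Qed.

(* The parallelogram law and the invariance of the law under Y (b, a) <->
   Y (~~ b, a) make the second moments add up without any centering. *)
Lemma diffw_moment (s : R) : (forall i j, i != j ->
   \int[P]_w (sqnorm2 R (Y i w - Y j w))%:E = s%:E)%E ->
  forall n b a, (\int[P]_w (sqnorm2 R (diffw Y b a n w))%:E = (n%:R * s)%:E)%E.
Proof.
move=> hs; elim=> [|n IH] b a.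
  rewrite mul0r; apply: integral0_eq => w _.
  by rewrite diffw0 /sqnorm2 /= expr0n /= addr0.
(* [K] exchanges the first two indices of [J], which negates the first increment and keeps the
   others. *)
set J := block b a n.+1; set K := [:: (~~ b, a), (b, a) & block b a.+1 n].
have uK : uniq K.
  rewrite /= uniq_block !inE !mem_block /= !ltnn /=.
  by rewrite xpair_eqE; case: (b).
have eJK : size J = size K by rewrite size_block /= size_block.
pose f s := (sqnorm2 R (altsum s))%:E.
have f0 t : (0 <= f t)%E by rewrite lee_fin sqnorm2_ge0.
have E1 := same_law_integral P f (sample_rv mY J) (sample_rv mY K) f0
  (sample_law mY iY lY (uniq_block b a n.+1) uK eJK).
set m := (\int[P]_w _)%E.
(* Adding the equal integrals over [J] and [K] cancels the cross term between the first increment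
   and the rest. *)
have mm : (m + m = (2 * (s + n%:R * s))%:E)%E.
  rewrite {2}/m [X in (_ + X)%E]E1 -ge0_integralD //=; last 2 first.
  - exact: (measurable_fun_discrete f (sample_rv mY J)).
  - exact: (measurable_fun_discrete f (sample_rv mY K)).
  pose g1 s : \bar R := if s is x :: y :: _ then (sqnorm2 R (x - y))%:E else 0%E.
  transitivity (\int[P]_w (2%:E * (sqnorm2 R (Y (b, a) w - Y (~~ b, a) w))%:E
      + 2%:E * (sqnorm2 R (diffw Y b a.+1 n w))%:E))%E.
    apply: eq_integral => w _; rewrite -!EFinM -!EFinD; congr EFin.
    rewrite -sqnorm2_parallelogram diffwS; congr (_ + _).
    by rewrite opprB.
  have m1 : measurable_fun setT
      (fun w => (sqnorm2 R (Y (b, a) w - Y (~~ b, a) w))%:E).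
    exact: (measurable_fun_discrete g1 (sample_rv mY J)).
  have m2 : measurable_fun setT (fun w => (sqnorm2 R (diffw Y b a.+1 n w))%:E).
    exact: (measurable_fun_discrete (fun z => (sqnorm2 R z)%:E) (diffw_rv b a.+1 n)).
  rewrite ge0_integralD //; last 4 first.
  - by move=> w _; rewrite -EFinM lee_fin mulr_ge0 // sqnorm2_ge0.
  - exact: measurable_funeM.
  - by move=> w _; rewrite -EFinM lee_fin mulr_ge0 // sqnorm2_ge0.
  - exact: measurable_funeM.
  rewrite !ge0_integralZl_EFin //; last 2 first.
  - by move=> w _; rewrite lee_fin sqnorm2_ge0.
  - by move=> w _; rewrite lee_fin sqnorm2_ge0.
  rewrite IH hs; last by rewrite xpair_eqE; case: (b).
  by rewrite -!EFinM -EFinD mulrDr.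
  by move=> w _; rewrite lee_fin sqnorm2_ge0.
(* Infinite values of [m] contradict [mm], whose right side is finite. *)
clearbody m; case: m mm => //= r [] h; congr EFin.
rewrite -natr1; lra.
Qed.

End DifferenceWalk.

(** * Lower bound for the return probability *)

Section ReturnProbability.
Context {d : measure_display} {T : measurableType d} {R : realType}.
Context {P : probability T R} {Y : bool * nat -> T -> Z2}.
Hypothesis mY : forall i, Z2_rv (Y i).
Hypothesis iY : mutually_independent P Y.
Hypothesis lY : forall i j, same_law P (Y i) (Y j).

(** All pairs of distinct indices have the same joint law, so one pair suffices; there
    [|a - b|^2 <= 2|a|^2 + 2|b|^2] gives finiteness. *)
Lemma difference_moment_finite (i0 : bool * nat) :
  (\int[P]_w (sqnorm2 R (Y i0 w))%:E < +oo)%E ->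
  exists2 s : R, 0 <= s & forall i j, i != j ->
    (\int[P]_w (sqnorm2 R (Y i w - Y j w))%:E = s%:E)%E.
Proof.
move=> fin.
pose I2 i j := (\int[P]_w (sqnorm2 R (Y i w - Y j w))%:E)%E.
pose f s : \bar R := if s is x :: y :: _ then (sqnorm2 R (x - y))%:E else 0%E.
have f0 t : (0 <= f t)%E.
  by case: t => [|? [|? ?]] //=; rewrite lee_fin sqnorm2_ge0.
have eI i j i' j' : i != j -> i' != j' -> I2 i j = I2 i' j'.
  move=> ij ij'.
  apply: (same_law_integral P f (sample_rv mY [:: i; j]) (sample_rv mY [:: i'; j'])) => //.
  by apply: (sample_law mY iY lY) => //=; rewrite inE ?ij ?ij'.
pose i1 := (false, 0%N); pose i2 := (true, 0%N).
pose m i := (\int[P]_w (sqnorm2 R (Y i w))%:E)%E.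
have mE i : m i = m i0.
  pose h (z : Z2) := (sqnorm2 R z)%:E.
  by apply: (same_law_integral P h (discrete_rvP (mY i)) (discrete_rvP (mY i0))) => [z|];
    [rewrite lee_fin sqnorm2_ge0 | exact: lY].
have mm i : measurable_fun setT (fun w => (sqnorm2 R (Y i w))%:E).
  exact: (measurable_fun_discrete (fun z => (sqnorm2 R z)%:E) (discrete_rvP (mY i))).
have I12fin : (I2 i1 i2 < +oo)%E.
  apply: (@le_lt_trans _ _ (2%:E * m i1 + 2%:E * m i2)%E); last first.
    by rewrite !mE lte_add_pinfty // lte_mul_pinfty ?lee_fin.
  rewrite -!ge0_integralZl_EFin //; last 2 first.
  - by move=> w _; rewrite lee_fin sqnorm2_ge0.
  - by move=> w _; rewrite lee_fin sqnorm2_ge0.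
  rewrite -ge0_integralD //; last 4 first.
  - by move=> w _; rewrite -EFinM lee_fin mulr_ge0 // sqnorm2_ge0.
  - exact: measurable_funeM.
  - by move=> w _; rewrite -EFinM lee_fin mulr_ge0 // sqnorm2_ge0.
  - exact: measurable_funeM.
  apply: ge0_le_integral => //.
  - by move=> w _; rewrite lee_fin sqnorm2_ge0.
  - exact: (measurable_fun_discrete f (sample_rv mY [:: i1; i2])).
  - by apply: emeasurable_funD; exact: measurable_funeM.
  move=> w _; rewrite -!EFinM -EFinD lee_fin addrC.
  have := sqnorm2_parallelogram (R := R) (Y i2 w) (Y i1 w).
  have := sqnorm2_ge0 (R := R) (Y i2 w + Y i1 w).
  by rewrite [- _ + _]addrC; lra.
have I12ge0 : (0 <= I2 i1 i2)%E.
  by apply: integral_ge0 => w _; rewrite lee_fin sqnorm2_ge0.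
exists (fine (I2 i1 i2)); first exact: fine_ge0.
move=> i j ij; rewrite fineK; last by rewrite ge0_fin_numE.
exact: eI.
Qed.

Lemma return_probability_ge (i0 : bool * nat) :
  (\int[P]_w (sqnorm2 R (Y i0 w))%:E < +oo)%E ->
  exists2 c : R, 0 < c & forall n, (0 < n)%N ->
    c / n%:R <= pr P [set w | diffw Y false 0 (n + n) w = 0].
Proof.
move=> /difference_moment_finite[s s0 hs].
have [K K0 sK] : exists2 K : nat, (0 < K)%N & s <= K%:R.
  by exists (Num.truncn s).+1 => //; apply/ltW/truncnS_gt.
(* Here [136 = 4 * 34]: the 4 comes from squaring the probability 1/2, the 34 from the box size
   bound [M2]. *)
exists (136 * K%:R)^-1; first by rewrite invr_gt0 mulr_gt0 // ltr0n.
move=> n n0.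
(* [M] will be least with [2nK <= M^2], so that the second moment [n s <= n K] is at most half of
   [M^2], as [chebyshev_half] demands. *)
have exM : exists M, (2 * (n * K) <= M ^ 2)%N by exists (2 * (n * K))%N; nia.
case: (ex_minnP exM) => M M1 minM.
have M0 : (0 < M)%N by nia.
(* With [u = M - 1], minimality gives [u^2 < 2nK], hence [(2u + 3)^2 <= 8u^2 + 18 < 16nK + 18 <=
   34nK]. *)
have M2 : (M.*2.+1 ^ 2 <= 34 * (n * K))%N.
  have : (M.-1 ^ 2 < 2 * (n * K))%N.
    by rewrite ltnNge; apply/negP => /minM; lia.
  nia.
(* [W] is the negated increment over the second half, so a return at time 2n is a collision of [V]
   and [W], which are independent and share a law. *)
pose V := diffw Y false 0 n; pose W := diffw Y true n n.
have VW w : (V w = W w) <-> (diffw Y false 0 (n + n) w = 0).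
  rewrite diffwD add0n /V /W (diffwN false).
  split=> [->|/eqP]; first by rewrite addNr.
  by rewrite addr_eq0 => /eqP.
rewrite (_ : [set w | _] = [set w | V w = W w]); last first.
  by apply/seteqP; split=> w /= /VW.
have mVW : measurable [set w | V w = W w].
  rewrite (_ : [set w | _] = [set w | diffw Y false 0 (n + n) w = 0]).
    exact: (diffw_rv mY false 0 (n + n) [set 0]).
  by apply/seteqP; split=> w /= /VW.
have mV := diffw_rv mY false 0 n; have mW := diffw_rv mY true n n.
have half : 2^-1 <= pr P [set w | V w \in box M].
  apply: (@le_trans _ _ (pr P [set w | sqnorm2 R (V w) < M%:R ^+ 2])).
    apply: (chebyshev_half P _ _ mV (sqnorm2_ge0 (R := R))).
      by rewrite exprn_gt0 // ltr0n.
    rewrite (diffw_moment mY iY lY s hs) lee_fin.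
    have : 2 * (n%:R * K%:R) <= M%:R ^+ 2 :> R.
      by rewrite -natrX -!natrM ler_nat.
    have : n%:R * s <= n%:R * K%:R by rewrite ler_wpM2l // ler0n.
    lra.
  apply: pr_le.
  - exact: (mV [set z | sqnorm2 R z < M%:R ^+ 2]).
  - exact: (mV [set z | z \in box M]).
  - by move=> w; exact: mem_box.
have iVW c c' : P [set w | V w = c /\ W w = c'] =
    (P [set w | V w = c] * P [set w | W w = c'])%E.
  exact: (sample_independent mY iY lY (uniq_block_cat false true 0 n n)
    [set s | altsum s = c] [set s | altsum s = c']).
have eVW c : P [set w | V w = c] = P [set w | W w = c].
  exact: (diffw_law mY iY lY false true 0 n n [set c]).
have szB : (0 < size (box M))%N by rewrite size_box expn_gt0.
apply: le_trans (collision_ge P mV mW mVW iVW eVW (uniq_box M) szB).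
rewrite size_box.
have B0 : 0 < (M.*2.+1 ^ 2)%:R :> R by rewrite ltr0n expn_gt0.
have nK0 : 0 < n%:R * K%:R :> R by rewrite -natrM ltr0n; nia.
apply: (@le_trans _ _ (4^-1 / (M.*2.+1 ^ 2)%:R)); last first.
  by rewrite ler_pM2r ?invr_gt0 //; move: half; nra.
rewrite -!invfM lef_pV2 ?posrE ?mulr_gt0 ?ltr0n ?expn_gt0 //.
have : (M.*2.+1 ^ 2)%:R <= 34 * (n%:R * K%:R) :> R.
  by rewrite -!natrM ler_nat.
lra.
Qed.

End ReturnProbability.

(** * Recurrence from the divergence of the return probabilities *)

Lemma harmonic_unbounded (R : realType) (A : R) :
  exists N, A <= \sum_(k < N) (k.+1)%:R^-1.
Proof.
apply: contrapT => nN; apply: (@dvg_harmonic R).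
apply: nondecreasing_is_cvgn.
  apply/nondecreasing_seqP => n.
  by rewrite /series /= big_nat_recr //= lerDl invr_ge0 ler0n.
exists A => _ [n _ <-]; rewrite leNgt; apply/negP => h.
apply: nN; exists n; rewrite -(big_mkord xpredT (fun k => (k.+1)%:R^-1)).
exact: ltW.
Qed.

Section Recurrence.
Context {d : measure_display} {T : measurableType d} {R : realType}.
Context {P : probability T R} {Y : bool * nat -> T -> Z2}.
Hypothesis mY : forall i, Z2_rv (Y i).
Hypothesis iY : mutually_independent P Y.
Hypothesis lY : forall i j, same_law P (Y i) (Y j).

Definition return_at (Y : bool * nat -> T -> Z2) n : set T :=
  [set w | diffw Y false 0 n w = 0].

(** Displacements are measured from time [a]; joined to [return_at Y a], this excludes visits to 0
    at times a+1 to a+N. *)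
Definition no_return (Y : bool * nat -> T -> Z2) a N : set T :=
  [set w | forall m, (1 <= m <= N)%N -> diffw Y false a m w <> 0].

(** Writing the event through a single sample makes [sample_law] and [sample_independent]
    applicable; m steps use the first 2m entries. *)
Lemma no_returnE a N : no_return Y a N = sample Y (block false a N) @^-1`
  [set s | forall m, (1 <= m <= N)%N -> altsum (take m.*2 s) <> 0].
Proof.
have E m w : (m <= N)%N ->
    diffw Y false a m w = altsum (take m.*2 (sample Y (block false a N) w)).
  move=> mN; rewrite /diffw -(subnKC mN) block_cat /sample map_cat take_size_cat //.
  by rewrite size_map size_block.
apply/seteqP; split=> w /= h m mN; have mN' : (m <= N)%N by case/andP: mN.
  by rewrite -E //; exact: h.
by rewrite E //; exact: h.
Qed.

Lemma measurable_return_at n : measurable (return_at Y n).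
Proof. exact: (diffw_rv mY false 0 n [set 0]). Qed.

Lemma measurable_no_return a N : measurable (no_return Y a N).
Proof. by rewrite no_returnE; exact: (sample_rv mY). Qed.

(** The two events use disjoint blocks of steps, and the law of the second does not depend on its
    starting time. *)
Lemma pr_last_return n N : pr P (return_at Y n `&` no_return Y n N) =
  pr P (return_at Y n) * pr P (no_return Y 0 N).
Proof.
have h : P (no_return Y n N) = P (no_return Y 0 N).
  rewrite !no_returnE; apply: (sample_law mY iY lY); rewrite ?uniq_block //.
  by rewrite !size_block.
have mr := measurable_return_at n; have mn := measurable_no_return 0 N.
rewrite /pr -fineM ?fin_num_measure // -h !no_returnE; congr fine.
exact: (sample_independent mY iY lY (uniq_block_cat false false 0 n N)
  [set s | altsum s = 0] _).
Qed.

Lemma no_return_mul_le1 N :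
  pr P (no_return Y 0 N) * \sum_(n < N.+1) pr P (return_at Y n) <= 1.
Proof.
(* [F n] says that the last return up to time [N] happens at [n]; these events are disjoint. *)
pose F n := if (n <= N)%N then return_at Y n `&` no_return Y n (N - n) else set0.
have mF n : measurable (F n).
  rewrite /F; case: ifP => // _; apply: measurableI.
    exact: measurable_return_at.
  exact: measurable_no_return.
have tF' i j w : (i < j)%N -> F i w -> F j w -> False.
  rewrite /F; case: ifP => // iN; case: ifP => // jN ij [ri ni] [rj _].
  apply: (ni (j - i)%N); first by lia.
  move: rj; rewrite /return_at /= -(subnKC (ltnW ij)) diffwD ri add0r add0n.
  by rewrite subnKC // ltnW.
have tF : trivIset setT F.
  move=> i j _ _ [w [Fi Fj]].
  by case: (ltngtP i j) => // ij; [case: (tF' i j w)|case: (tF' j i w)].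
have : (\sum_(n < N.+1) P (F n) <= 1)%E.
  rewrite -measure_bigsetU //; apply: probability_le1.
  by apply: bigsetU_measurable => n _.
rewrite (eq_bigr (fun n : 'I_N.+1 => (pr P (F n))%:E)); last first.
  by move=> n _; rewrite prE.
rewrite sumEFin lee_fin; apply: le_trans.
rewrite mulr_sumr; apply: ler_sum => n _.
rewrite /F -ltnS ltn_ord pr_last_return mulrC ler_wpM2l ?pr_ge0 //.
(* Avoiding a return for [N] steps is stronger than avoiding it for [N - n]. *)
apply: pr_le; [exact: measurable_no_return|exact: measurable_no_return|].
by move=> w h m mN; apply: h; lia.
Qed.

Variable c : R.
Hypothesis c0 : 0 < c.
Hypothesis return_ge : forall n, (0 < n)%N ->
  c / n%:R <= pr P (return_at Y (n + n)).

Lemma sum_return_ge N :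
  c * \sum_(k < N) (k.+1)%:R^-1 <= \sum_(n < N.*2.+1) pr P (return_at Y n).
Proof.
elim: N => [|N IH].
  by rewrite big_ord0 mulr0 sumr_ge0 // => n _; exact: pr_ge0.
rewrite big_ord_recr /= mulrDr doubleS.
(* Two terms are split off: the odd time is discarded and the even time 2N+2 pays for the new
   harmonic term. *)
rewrite [leRHS]big_ord_recr /= [X in _ <= X + _]big_ord_recr /=.
apply: lerD; last by rewrite (_ : N.*2.+2 = N.+1 + N.+1)%N ?return_ge//; lia.
by rewrite (le_trans IH) // lerDl pr_ge0.
Qed.

Lemma no_return_small e : 0 < e -> exists N, pr P (no_return Y 0 N) <= e.
Proof.
(* This level makes [c] times the harmonic sum at least [e^-1]. *)
move=> e0; have [N hN] := @harmonic_unbounded R ((c * e)^-1).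
exists N.*2.
have := no_return_mul_le1 N.*2; have := sum_return_ge N.
have : e^-1 <= c * \sum_(k < N) (k.+1)%:R^-1.
  by rewrite -ler_pdivrMl // -invfM.
set q := pr P _; set S := \sum_(n < _) _; set H := c * _ => h1 h2 h3.
have q0 : 0 <= q by exact: pr_ge0.
have : q * e^-1 <= 1.
  by apply: le_trans h3; rewrite ler_wpM2l // (le_trans h1).
by rewrite ler_pdivrMr // mul1r.
Qed.

Definition last_return n : set T :=
  return_at Y n `&` [set w | forall m, (0 < m)%N -> diffw Y false n m w <> 0].

Lemma measurable_last_return n : measurable (last_return n).
Proof.
apply: measurableI; first exact: measurable_return_at.
rewrite (_ : [set w | _] = \bigcap_(N in setT) no_return Y n N).
  by apply: bigcap_measurable => // N _; exact: measurable_no_return.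
apply/seteqP; split=> w /= h; first by move=> N _ m /andP[m0 _]; exact: h.
by move=> m m0; apply: (h m) => //; rewrite m0 leqnn.
Qed.

(** For every [N] the event forces [N] steps without return after time [n], whose probability is
    arbitrarily small by [no_return_small]. *)
Lemma last_return_null n : P (last_return n) = 0%E.
Proof.
have mA := measurable_last_return n.
rewrite (prE P mA); congr EFin; apply/eqP; rewrite eq_le pr_ge0 andbT.
apply/ler_addgt0Pl => e e0; rewrite addr0.
have [N hN] := no_return_small e e0.
apply: le_trans hN.
apply: (@le_trans _ _ (pr P (return_at Y n `&` no_return Y n N))).
  apply: pr_le => //.
    by apply: measurableI; [exact: measurable_return_at|exact: measurable_no_return].
  by move=> w [r h]; split=> // m /andP[m0 _]; exact: h.
rewrite pr_last_return ler_piMl ?pr_ge0 //.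
rewrite -(pr_setT P); apply: pr_le => //; exact: measurable_return_at.
Qed.

Lemma infinitely_many_returns :
  {ae P, forall w, forall N, exists2 n, (N <= n)%N & diffw Y false 0 n w = 0}.
Proof.
have h n : {ae P, forall w, ~ last_return n w}.
  exists (last_return n); split; [exact: measurable_last_return|exact: last_return_null|].
  by move=> w /contrapT.
have := ae_foralln h.
(* Time 0 is a return, and off the null sets no return is the last, so each one found leads to a
   later one. *)
apply: filterS => w {}h; elim=> [|N [n Nn rn]]; first by exists 0%N.
have : exists2 m, (0 < m)%N & diffw Y false n m w = 0.
  apply: contrapT => nm; apply: (h n); split=> // m m0 e.
  by apply: nm; exists m.
move=> [m m0 e]; exists (n + m)%N; first by lia.
by rewrite diffwD rn e addr0.
Qed.

End Recurrence.

(** * Reindexing and passage to the two walks *)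

Lemma mutually_independent_comp {d : measure_display} {T : measurableType d}
    {R : realType} {P : probability T R} {I J : eqType} (f : J -> I)
    (Y : I -> T -> Z2) :
  injective f -> mutually_independent P Y ->
  mutually_independent P (fun j => Y (f j)).
Proof.
move=> fi iY S B uS.
(* This avoids inverting [f]: injectivity leaves one constraint at [f j], and indices outside the
   image of [S] get the full set. *)
pose B' i : set Z2 := [set z | forall j, j \in S -> f j = i -> B j z].
have BE j : j \in S -> B' (f j) = B j.
  move=> jS; apply/seteqP; split=> z /=; first by move=> /(_ j jS erefl).
  by move=> Bz k _ /fi ->.
have := iY (map f S) B'; rewrite map_inj_uniq // => /(_ uS).
rewrite big_map => h.
rewrite (_ : [set w | _] = [set w | forall i, i \in map f S -> B' i (Y i w)]).
  by rewrite h; apply: eq_big_seq => j jS; rewrite BE.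
apply/seteqP; split=> w /= H.
  by move=> i /seq.mapP[j jS ->]; rewrite BE //; exact: H.
by move=> j jS; rewrite -BE //; apply: H; exact: map_f.
Qed.

Lemma diffw_sum {d : measure_display} {T : measurableType d}
    (Y : bool * nat -> T -> Z2) b a n w :
  diffw Y b a n w = \sum_(a <= k < a + n) (Y (b, k) w - Y (~~ b, k) w).
Proof.
elim: n a => [|n IH] a; first by rewrite addn0 big_geq.
by rewrite diffwS IH addSnnS [RHS]big_ltn //; lia.
Qed.

(** The starting points cancel; the successor reconciles steps numbered from 1 with blocks numbered
    from 0. *)
Lemma walk_sub_diffw {d : measure_display} {T : measurableType d} (x : Z2)
    (X : bool * nat -> T -> Z2) n w :
  walk x (fun k => X (false, k)) n w - walk x (fun k => X (true, k)) n w =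
  diffw (fun j => X (j.1, j.2.+1)) false 0 n w.
Proof.
by rewrite /walk opprD addrACA subrr add0r -sumrB big_add1 diffw_sum.
Qed.

(* X (false, k) = X^(1)_k and X (true, k) = X^(2)_k, for k >= 1. *)
Theorem mainTheorem1 (d : measure_display) (T : measurableType d)
  (R : realType) (P : probability T R) (x : Z2) (X : bool * nat -> T -> Z2) :
  (forall i k, (1 <= k)%N -> Z2_rv (X (i, k))) ->
  mutually_independent P
    (fun j : {j : bool * nat | (1 <= j.2)%N} => X (val j)) ->
  (forall i k, (1 <= k)%N -> same_law P (X (i, k)) (X (false, 1%N))) ->
  (\int[P]_w (sqnorm2 R (X (false, 1%N) w))%:E < +oo)%E ->
  {ae P, forall w, forall N : nat, exists2 n : nat, (N <= n)%N &
      walk x (fun k => X (false, k)) n w = walk x (fun k => X (true, k)) n w}.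

Proof.
move=> mX iX lX fin.
pose Y (j : bool * nat) := X (j.1, j.2.+1).
have mY j : Z2_rv (Y j) by exact: mX.
have lY i j : same_law P (Y i) (Y j).
  by move=> B; rewrite (lX i.1 i.2.+1 isT B) (lX j.1 j.2.+1 isT B).
pose f (j : bool * nat) : {j : bool * nat | (1 <= j.2)%N} :=
  exist _ (j.1, j.2.+1) isT.
have iY : mutually_independent P Y.
  apply: (mutually_independent_comp f _ _ iX).
  by move=> [b k] [b' k'] [-> ->].
have [c c0 hc] := return_probability_ge mY iY lY (false, 0%N) fin.
have := infinitely_many_returns mY iY lY c c0 hc.
apply: filterS => w h N; have [n Nn e] := h N.
exists n => //; apply/eqP; rewrite -subr_eq0 walk_sub_diffw; exact/eqP.
Qed.
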